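(* Given a pointed pair of diffeological spaces $(X,A,x_0)$, there is an exact sequence of pointed sets $$\cdots\to\pi_{n+1}(X,A,x_0)\xrightarrow{\Delta}\pi_n(A,x_0)\xrightarrow{i_*}\pi_n(X,x_0)\xrightarrow{j_*}\pi_n(X,A,x_0)\to\cdots$$ $$\cdots\to\pi_1(X,A,x_0)\xrightarrow{\Delta}\pi_0(A,x_0)\xrightarrow{i_*}\pi_0(X,x_0).$$
   Context: A pointed pair $(X,A,x_0)$ is a diffeological space $X$, a subspace $A\subset X$ (with the subspace diffeology) and a point $x_0\in A$. $I=[0,1]$, $I^n$ and their subsets have the subspace diffeology from $\mathbf{R}^n$. For $n\ge1$ put $J^{n-1}=\partial I^{n-1}\times I\cup I^{n-1}\times\{1\}\subset\partial I^n$. $\pi_n(X,x_0)$ ($n\ge0$) is the set of homotopy classes of smooth maps of pairs $(I^n,\partial I^n)\to(X,x_0)$, and $\pi_n(X,A,x_0)$ ($n\ge1$) is the set of homotopy classes of smooth maps of triples $(I^n,\partial I^n,J^{n-1})\to(X,A,x_0)$; homotopies are smooth maps $I^n\times I\to X$ through maps of pairs, respectively triples. Both are pointed by the class of the constant map at $x_0$ ($\pi_0(X,x_0)$ is the set of smooth path components pointed by the component of $x_0$). $i_*\colon\pi_n(A,x_0)\to\pi_n(X,x_0)$ and $j_*\colon\pi_n(X,x_0)\to\pi_n(X,A,x_0)$ are induced by the inclusions $(A,x_0)\to(X,x_0)$ and $(X,x_0,x_0)\to(X,A,x_0)$, where for $n\ge1$ $\pi_n(X,x_0)$ is identified with $\pi_n(X,x_0,x_0)$.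 $\Delta\colon\pi_n(X,A,x_0)\to\pi_{n-1}(A,x_0)$ ($n\ge1$) sends the class of $\phi\colon(I^n,\partial I^n,J^{n-1})\to(X,A,x_0)$ to the class of its restriction to $I^{n-1}=I^{n-1}\times\{0\}\subset I^n$. *)

(* Defs.v *)
From HB Require Import structures.
From mathcomp Require Import all_boot all_order all_algebra.
From mathcomp Require Import all_classical all_reals all_analysis.

Set Implicit Arguments.
Unset Strict Implicit.
Unset Printing Implicit Defensive.

Import Order.TTheory GRing.Theory Num.Theory.
Import numFieldNormedType.Exports.
Local Open Scope classical_set_scope.
Local Open Scope ring_scope.

Section Smooth.
Variable R : realType.
Implicit Types V W X : normedModType R.

(* C^k: differentiable (in the sense of Frechet) with all directional
   derivatives of class C^(k-1), C^0 being continuity; f is total but only its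
   germs at points of U matter, and U is meant to be open. *)
Fixpoint Ck V W (k : nat) (U : set V) (f : V -> W) : Prop :=
  if k is k'.+1 then
    (forall x, U x -> differentiable f x) /\ (forall v, Ck k' U ('D_v f))
  else forall x, U x -> {for x, continuous f}.

Definition smooth_on V W (U : set V) (f : V -> W) := forall k, Ck k U f.

Lemma near_eq_differentiable V W (f g : V -> W) (x : V) :
  {near x, f =1 g} -> differentiable f x -> differentiable g x.
Proof.
move=> fg /diff_locallyP [cdf ef].
suff eg : g \o shift x = cst (g x) + 'd f x +o_0 id.
  by apply/diff_locallyP; rewrite (diff_unique cdf eg).
have fgx : f x = g x by exact: nbhs_singleton fg.
apply/eqaddoP => e e0; move/eqaddoP : ef => /(_ e e0) ef.
have fg0 : \forall y \near 0, f (y + x) = g (y + x).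
  have shx : (fun y : V => y + x) @ (0 : V) --> x.
    rewrite -[X in _ --> X]add0r; apply: cvgD; [exact: cvg_id|exact: cvg_cst].
  exact: shx _ fg.
near=> y.
have -> : (g \o shift x - (cst (g x) + 'd f x)) y
        = (f \o shift x - (cst (f x) + 'd f x)) y.
  rewrite !fctE /= fgx; congr (_ - _).
  by symmetry; near: y.
by near: y.
Unshelve. all: by end_near. Qed.

Lemma Ck_ext V W k (U : set V) (f g : V -> W) :
  open U -> (forall x, U x -> f x = g x) -> Ck k U f -> Ck k U g.
Proof.
move=> oU; have nU x : U x -> \forall y \near x, U y by move=> Ux; exact: open_nbhs_nbhs.
elim: k f g => [|k IH] f g fg /=.
  move=> cf x Ux; suff : g @ x --> g x by [].
  have cfx : f @ x --> f x by exact: cf.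
  rewrite -(fg x Ux); apply: cvg_trans cfx; apply: near_eq_cvg.
  by near=> y; apply: fg; near: y; exact: nU.
move=> [df Df]; split=> [x Ux|v].
  apply: near_eq_differentiable (df x Ux).
  by near=> y; apply: fg; near: y; exact: nU.
apply: IH (Df v) => x Ux; apply: near_eq_derive.
by near=> y; apply: fg; near: y; exact: nU.
Unshelve. all: by end_near. Qed.

Lemma Ck_local V W k (U : set V) (f : V -> W) :
  (forall x, U x -> exists2 U', U' x & Ck k U' f) -> Ck k U f.
Proof.
elim: k f => [|k IH] f /= H.
  by move=> x Ux; have [U' U'x] := H x Ux; apply.
split=> [x Ux|v]; first by have [U' U'x []] := H x Ux => + _; apply.
by apply: IH => x Ux; have [U' U'x [_]] := H x Ux; exists U'.
Qed.

Lemma CkS V W k (U : set V) (f : V -> W) : Ck k.+1 U f -> Ck k U f.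
Proof.
elim: k f => [|k IH] f; first by move=> [df _] x Ux; exact/differentiable_continuous/df.
by move=> [df Df]; split => // v; exact/IH/Df.
Qed.

Lemma Ck_cst V W k (U : set V) (a : W) : Ck k U (fun=> a).
Proof.
elim: k a => [|k IH] a /=; first by move=> x _; exact: cst_continuous.
split=> [x _|v]; first exact: differentiable_cst.
have -> : 'D_v (fun _ : V => a) = fun=> 0 :> W; last exact: IH.
by apply/funext => x; exact: derive_cst.
Qed.

Lemma CkD V W k (U : set V) (f g : V -> W) : open U ->
  Ck k U f -> Ck k U g -> Ck k U (fun x => f x + g x).
Proof.
move=> oU; elim: k f g => [|k IH] f g /=.
  by move=> cf cg x Ux; apply: continuousD; [exact: cf|exact: cg].
move=> [df Df] [dg Dg]; split=> [x Ux|v].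
  by apply: differentiableD; [exact: df|exact: dg].
apply: Ck_ext (IH _ _ (Df v) (Dg v)) => // x Ux.
by rewrite -deriveD//; apply: diff_derivable; [exact: df|exact: dg].
Qed.

Lemma Ck_sum V W k (U : set V) n (f : 'I_n -> V -> W) : open U ->
  (forall i, Ck k U (f i)) -> Ck k U (fun x => \sum_i f i x).
Proof.
move=> oU; elim: n f => [|n IH] f fk.
  rewrite (_ : (fun _ => _) = fun=> 0); first exact: Ck_cst.
  by apply/funext => x; rewrite big_ord0.
rewrite (_ : (fun _ => _) = fun x => f ord0 x + \sum_i f (lift ord0 i) x).
  by apply: CkD => //; exact: IH.
by apply/funext => x; rewrite big_ord_recl.
Qed.

Lemma differentiable_scale V W (a : V -> R) (f : V -> W) (x : V) :
  differentiable a x -> differentiable f x ->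
  differentiable (fun y => a y *: f y) x /\
  forall v, 'D_v (fun y => a y *: f y) x = 'D_v a x *: f x + a x *: 'D_v f x.
Proof.
move=> da df.
have bil : bilinear_for (GRing.Scale.Law.clone _ _ *:%R _)
    (GRing.Scale.Law.clone _ _ *:%R _) ( *:%R : R -> W -> W).
  split=> [u|u] b y z /=; first by rewrite scalerDl scalerA.
  by rewrite scalerDr !scalerA mulrC.
pose bM := bilinear_isBilinear.Build R R W W _ _ ( *:%R : R -> W -> W) bil.
pose B : {bilinear R -> W -> W} := HB.pack ( *:%R : R -> W -> W) bM.
have cB : continuous (fun p : R * W => B p.1 p.2) by exact: scale_continuous.
have dB p := differentiable_bilin p cB.
have dp := differentiable_pair da df.
have -> : (fun y => a y *: f y) = (fun p : R * W => B p.1 p.2) \o (fun y => (a y, f y)).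
  by [].
have dc : differentiable ((fun p : R * W => B p.1 p.2) \o (fun y => (a y, f y))) x.
  exact: differentiable_comp.
split=> // v.
rewrite !deriveE// diff_comp//= (diff_bilin _ cB) (diff_pair da df)/= addrC.
by [].
Qed.

Lemma CkZ V W k (U : set V) (a : V -> R) (f : V -> W) : open U ->
  Ck k U a -> Ck k U f -> Ck k U (fun x => a x *: f x).
Proof.
move=> oU; elim: k a f => [|k IH] a f /=.
  by move=> ca cf x Ux; apply: cvgZ; [exact: ca|exact: cf].
move=> ca cf; have [[da Da] [df Df]] := (ca, cf); split=> [x Ux|v].
  by have [] := differentiable_scale (da x Ux) (df x Ux).
apply: (@Ck_ext _ _ _ _ (fun x => 'D_v a x *: f x + a x *: 'D_v f x)) => // [x Ux|].
  by have [_ ->] := differentiable_scale (da x Ux) (df x Ux).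
by apply: CkD => //; apply: IH => //; exact: CkS.
Qed.

Lemma Ck_lin V W X k (U : set V) (L : {linear W -> X}) (f : V -> W) : open U ->
  continuous L -> Ck k U f -> Ck k U (L \o f).
Proof.
move=> oU cL; elim: k f => [|k IH] f /=.
  by move=> cf x Ux; apply: continuous_comp; [exact: cf|exact: cL].
move=> [df Df]; split=> [x Ux|v].
  by apply: differentiable_comp; [exact: df|exact: linear_differentiable].
apply: Ck_ext (IH _ (Df v)) => // x Ux /=.
have dL : differentiable L (f x) by exact: linear_differentiable.
have -> : 'D_v f x = 'd f x v by apply: deriveE; exact: df.
have -> : 'D_v (L \o f) x = 'd (L \o f) x v.
  by apply: deriveE; apply: differentiable_comp => //; exact: df.
have -> : 'd (L \o f) x = 'd L (f x) \o 'd f x :> (_ -> _).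
  by apply: diff_comp => //; exact: df.
by rewrite (diff_lin (f x) cL).
Qed.

Lemma Ck_id V k (U : set V) : Ck k U id.
Proof.
case: k => [|k]; first by move=> x _; exact: cvg_id.
split=> [x _|v]; first exact: ex_diff.
rewrite (_ : 'D_v id = fun=> v); first exact: Ck_cst.
by apply/funext => x; exact: derive_id.
Qed.

Lemma Ck_coord V k m n (U : set V) (f : V -> 'M[R]_(m, n)) i j : open U ->
  Ck k U f -> Ck k U (fun x => f x i j : R).
Proof.
move=> oU fk.
have lin : linear (fun N : 'M[R]_(m, n) => N i j : R^o) by move=> ? ? ?; rewrite !mxE.
pose LM := GRing.isLinear.Build _ _ _ _ _ lin.
pose L : {linear 'M[R]_(m, n) -> R^o} := HB.pack (fun N : 'M[R]_(m, n) => N i j : R^o) LM.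
by apply: (@Ck_lin _ _ R^o _ _ L) fk => //; exact: coord_continuous.
Qed.

Lemma Ck_row V k n (U : set V) (f : V -> 'rV[R]_n) : open U ->
  (forall j, Ck k U (fun x => f x 0 j : R)) -> Ck k U f.
Proof.
move=> oU fk; rewrite (_ : f = fun x => \sum_j f x 0 j *: 'e_j).
  by apply: Ck_sum => // j; apply: CkZ => //; exact: Ck_cst.
by apply/funext => x; rewrite -row_sum_delta.
Qed.

Lemma Ck_comp V W k n (U : set V) (U' : set 'rV[R]_n) (f : V -> 'rV[R]_n)
    (g : 'rV[R]_n -> W) : open U -> {homo f : x / U x >-> U' x} ->
  Ck k U f -> Ck k U' g -> Ck k U (g \o f).
Proof.
move=> oU fU; elim: k g => [|k IH] g.
  by move=> cf cg x Ux; apply: continuous_comp; [exact: cf|exact/cg/fU].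
move=> fk [dg Dg]; have [df Df] := fk; split=> [x Ux|v].
  by apply: differentiable_comp; [exact: df|exact/dg/fU].
apply: (@Ck_ext _ _ _ _ (fun x => \sum_j 'D_v f x 0 j *: ('D_('e_j) g \o f) x)).
- by [].
- move=> x Ux; have dfx := df x Ux; have dgx := dg _ (fU x Ux).
  have -> : 'D_v (g \o f) x = 'd (g \o f) x v.
    by apply: deriveE; exact: differentiable_comp.
  have -> : 'd (g \o f) x = 'd g (f x) \o 'd f x :> (_ -> _) by exact: diff_comp.
  rewrite /= -(deriveE v dfx) [in RHS](row_sum_delta ('D_v f x)) linear_sum.
  by apply: eq_bigr => j _; rewrite linearZ /= (deriveE _ dgx).
- apply: Ck_sum => // j; apply: CkZ => //; first exact/Ck_coord/Df.
  by apply: IH; [exact: CkS fk|exact: Dg].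
Qed.

End Smooth.

(* The plots of a diffeological space X are maps p : U -> X with U open in some
   R^n, n >= 0. Such a p is encoded by an arbitrary total extension 'rV_n -> X
   together with its domain U; by plot_ext the values outside U are irrelevant.
   (On an empty X there is no total map at all, which is harmless: the only
   plots that are lost are those with empty domain.) *)
HB.mixin Record hasDiffeology (R : realType) (X : Type) := {
  plot : forall n : nat, set 'rV[R]_n -> ('rV[R]_n -> X) -> Prop ;
  plot_open : forall n (U : set 'rV[R]_n) p, plot n U p -> open U ;
  plot_ext : forall n (U : set 'rV[R]_n) p q,
    (forall u, U u -> p u = q u) -> plot n U p -> plot n U q ;
  plot_cst : forall n (U : set 'rV[R]_n) (x : X), open U -> plot n U (fun=> x) ;
  plot_local : forall n (U : set 'rV[R]_n) p, open U ->
    (forall u, U u -> exists V, [/\ V u, V `<=` U & plot n V p]) -> plot n U p ;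
  plot_comp : forall m n (V : set 'rV[R]_m) (U : set 'rV[R]_n)
      (h : 'rV[R]_m -> 'rV[R]_n) p,
    open V -> smooth_on V h -> {homo h : v / V v >-> U v} ->
    plot n U p -> plot m V (p \o h)
}.

#[short(type="diffeologicalType")]
HB.structure Definition Diffeological (R : realType) :=
  {X of hasDiffeology R X}.

Arguments plot {R s} [n] U p.

Definition smooth (R : realType) (X Y : diffeologicalType R) (f : X -> Y) :=
  forall n (U : set 'rV[R]_n) (p : 'rV[R]_n -> X), plot U p -> plot U (f \o p).

Section EuclideanDiffeology.
Variables (R : realType) (d : nat).

Definition rV_plot n (U : set 'rV[R]_n) (p : 'rV[R]_n -> 'rV[R]_d) :=
  open U /\ smooth_on U p.

Fact rV_plot_open n (U : set 'rV[R]_n) p : rV_plot U p -> open U.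
Proof. by case. Qed.

Fact rV_plot_ext n (U : set 'rV[R]_n) p q :
  (forall u, U u -> p u = q u) -> rV_plot U p -> rV_plot U q.
Proof. by move=> pq [oU sp]; split=> // k; exact: Ck_ext (sp k). Qed.

Fact rV_plot_cst n (U : set 'rV[R]_n) (x : 'rV[R]_d) :
  open U -> rV_plot U (fun=> x).
Proof. by move=> oU; split=> // k; exact: Ck_cst. Qed.

Fact rV_plot_local n (U : set 'rV[R]_n) (p : 'rV[R]_n -> 'rV[R]_d) : open U ->
  (forall u, U u -> exists V, [/\ V u, V `<=` U & rV_plot V p]) -> rV_plot U p.
Proof.
move=> oU pU; split=> // k; apply: Ck_local => u Uu.
by have [V [Vu _ [_ sp]]] := pU u Uu; exists V.
Qed.

Fact rV_plot_comp m n (V : set 'rV[R]_m) (U : set 'rV[R]_n)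
    (h : 'rV[R]_m -> 'rV[R]_n) p : open V -> smooth_on V h ->
  {homo h : v / V v >-> U v} -> rV_plot U p -> rV_plot V (p \o h).
Proof. by move=> oV sh hU [oU sp]; split=> // k; exact: (Ck_comp oV hU). Qed.

HB.instance Definition _ := hasDiffeology.Build R 'rV[R]_d
  rV_plot_open rV_plot_ext rV_plot_cst rV_plot_local rV_plot_comp.

End EuclideanDiffeology.

Section SubspaceDiffeology.
Variables (R : realType) (X : diffeologicalType R) (A : set X).

Definition sub_plot n (U : set 'rV[R]_n) (p : 'rV[R]_n -> A) :=
  plot U (\val \o p).

Fact sub_plot_open n (U : set 'rV[R]_n) p : sub_plot U p -> open U.
Proof. exact: plot_open. Qed.

Fact sub_plot_ext n (U : set 'rV[R]_n) p q :
  (forall u, U u -> p u = q u) -> sub_plot U p -> sub_plot U q.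
Proof. by move=> pq; apply: plot_ext => u Uu /=; rewrite pq. Qed.

Fact sub_plot_cst n (U : set 'rV[R]_n) (x : A) :
  open U -> sub_plot U (fun=> x).
Proof. exact: plot_cst. Qed.

Fact sub_plot_local n (U : set 'rV[R]_n) (p : 'rV[R]_n -> A) : open U ->
  (forall u, U u -> exists V, [/\ V u, V `<=` U & sub_plot V p]) -> sub_plot U p.
Proof. exact: plot_local. Qed.

Fact sub_plot_comp m n (V : set 'rV[R]_m) (U : set 'rV[R]_n)
    (h : 'rV[R]_m -> 'rV[R]_n) p : open V -> smooth_on V h ->
  {homo h : v / V v >-> U v} -> sub_plot U p -> sub_plot V (p \o h).
Proof. exact: plot_comp. Qed.

HB.instance Definition _ := hasDiffeology.Build R (set_type A)
  sub_plot_open sub_plot_ext sub_plot_cst sub_plot_local sub_plot_comp.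

End SubspaceDiffeology.

Section SmoothMaps.
Variable R : realType.
Implicit Types X Y Z : diffeologicalType R.

Lemma smooth_cst X Y (y : Y) : smooth (fun _ : X => y).
Proof. by move=> n U p pU; apply: plot_cst; exact: plot_open pU. Qed.

Lemma smooth_comp X Y Z (f : X -> Y) (g : Y -> Z) :
  smooth f -> smooth g -> smooth (g \o f).
Proof. by move=> sf sg n U p /sf; exact: sg. Qed.

Lemma smooth_val X (A : set X) : smooth (\val : A -> X).
Proof. by []. Qed.

Lemma smooth_corestrict X Y (A : set Y) (f : X -> A) :
  smooth (\val \o f : X -> Y) -> smooth f.
Proof. by []. Qed.

End SmoothMaps.

Section Cubes.
Variable R : realType.

Definition unit_interval : set R := `[0, 1].

Definition cube n : set 'rV[R]_n := [set x | forall i, unit_interval (x 0 i)].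
Arguments cube n : clear implicits.

(* The topological boundary of I^n in R^n; it is empty for n = 0. *)
Definition boundary n : set (cube n) :=
  [set x : cube n | exists i, (\val x) 0 i = 0 \/ (\val x) 0 i = 1].
Arguments boundary n : clear implicits.

Fact unit_interval0 : (0 : R) \in unit_interval.
Proof. by rewrite inE /unit_interval/= in_itv/= lexx ler01. Qed.

Fact unit_interval1 : (1 : R) \in unit_interval.
Proof. by rewrite inE /unit_interval/= in_itv/= lexx ler01. Qed.

Definition unit0 : unit_interval := SigSub unit_interval0.
Definition unit1 : unit_interval := SigSub unit_interval1.

(* I^n x I is identified with I^(n+1), the parameter in I being the last
   coordinate: snoc x t is the point (x, t). *)
Fact snoc_subproof n (x : cube n) (t : unit_interval) :
  row_mx (\val x) (\val t)%:M \in cube (n + 1).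
Proof.
rewrite inE => i; rewrite mxE; case: splitP => k _; first exact: (set_mem (valP x)).
by rewrite mxE ord1 mulr1n; exact: (set_mem (valP t)).
Qed.

Definition snoc n (x : cube n) (t : unit_interval) : cube (n + 1) :=
  SigSub (snoc_subproof x t).

(* J^n = boundary(I^n) x I  U  I^n x {1}, a subset of I^(n+1). *)
Definition Jset n : set (cube (n + 1)) :=
  [set z | exists x t, z = snoc x t /\ (boundary n x \/ t = unit1)].
Arguments Jset n : clear implicits.

Lemma boundary_snoc n (x : cube n) (t : unit_interval) :
  boundary _ (snoc x t) <-> [\/ boundary _ x, t = unit0 | t = unit1].
Proof.
split=> [[i]|].
  rewrite /= mxE; case: splitP => k _; first by move=> xk; constructor 1; exists k.
  by rewrite mxE ord1 mulr1n => -[] t01; [constructor 2|constructor 3]; exact/val_inj.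
case=> [[i xi]|->|->].
- by exists (lshift 1 i); rewrite /= row_mxEl.
- by exists (rshift n 0); left; rewrite /= row_mxEr mxE.
- by exists (rshift n 0); right; rewrite /= row_mxEr mxE.
Qed.

Lemma Jset_sub_boundary n : Jset n `<=` boundary (n + 1).
Proof.
move=> _ [x [t [-> xt]]]; apply/boundary_snoc.
by case: xt => h; [constructor 1|constructor 3].
Qed.

Lemma smooth_snoc n (t : unit_interval) : smooth (fun x : cube n => snoc x t).
Proof.
move=> m U p [oU sp]; split=> // k; apply: Ck_row => // j.
case: (split_ordP j) => i ->.
  rewrite (_ : (fun _ => _) = fun u => (\val \o p) u 0 i); first exact/Ck_coord/sp.
  by apply/funext => u; rewrite /= row_mxEl.
rewrite (_ : (fun _ => _) = fun=> \val t); first exact: Ck_cst.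
by apply/funext => u; rewrite /= row_mxEr mxE ord1.
Qed.

End Cubes.

Arguments unit_interval R : clear implicits.
Arguments cube R n : clear implicits.
Arguments boundary R n : clear implicits.
Arguments Jset R n : clear implicits.

Section HomotopyClasses.
Variables (R : realType) (n : nat) (X : diffeologicalType R).
Variable P : set (cube R n -> X).

(* P is the set of admissible maps (maps of pairs or of triples), and a
   homotopy is a smooth map I^n x I -> X all of whose stages are in P. *)
Definition homotopic (f g : cube R n -> X) :=
  exists H : cube R (n + 1) -> X, [/\ smooth H,
    forall x, H (snoc x (unit0 R)) = f x, forall x, H (snoc x (unit1 R)) = g x &
    forall t, P (fun x => H (snoc x t))].

Definition homotopy_class (f : cube R n -> X) : set (cube R n -> X) :=
  [set g | homotopic f g].

(* The set of the classes [f], f in P, each class being the set of all maps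
   homotopic to f. *)
Definition homotopy_classes := set_type (homotopy_class @` P).

Definition hclass (f : P) : homotopy_classes :=
  SigSub (mem_set (imageP homotopy_class (set_mem (valP f)))).

End HomotopyClasses.

Arguments hclass {R n X P} f.

Section HomotopySets.
Variables (R : realType) (n : nat).

Definition pair_maps (X : diffeologicalType R) (x0 : X) : set (cube R n -> X) :=
  [set f | smooth f /\ f @` boundary R n `<=` [set x0]].

Definition triple_maps (X : diffeologicalType R) (A : set X) (x0 : A) :
    set (cube R (n + 1) -> X) :=
  [set f | [/\ smooth f, f @` boundary R (n + 1) `<=` A &
               f @` Jset R n `<=` [set \val x0]]].

(* hpi n x0 is pi_n(X, x0); hpi_rel n x0 is the relative set pi_(n+1)(X, A, x0),
   for n >= 0. *)
Definition hpi (X : diffeologicalType R) (x0 : X) :=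
  homotopy_classes (pair_maps x0).

Definition hpi_rel (X : diffeologicalType R) (A : set X) (x0 : A) :=
  homotopy_classes (triple_maps x0).

Fact cst_pair_subproof (X : diffeologicalType R) (x0 : X) :
  (fun=> x0) \in pair_maps x0.
Proof. by rewrite inE; split; [exact: smooth_cst|move=> _ [x _ <-]]. Qed.

Definition cst_pair (X : diffeologicalType R) (x0 : X) : pair_maps x0 :=
  SigSub (cst_pair_subproof x0).

Fact cst_triple_subproof (X : diffeologicalType R) (A : set X) (x0 : A) :
  (fun=> \val x0) \in triple_maps x0.
Proof.
rewrite inE; split; first exact: smooth_cst.
  by move=> _ [x _ <-]; exact: (set_mem (valP x0)).
by move=> _ [x _ <-].
Qed.

Definition cst_triple (X : diffeologicalType R) (A : set X) (x0 : A) :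
  triple_maps x0 := SigSub (cst_triple_subproof x0).

Definition hpi_pt (X : diffeologicalType R) (x0 : X) : hpi x0 :=
  hclass (cst_pair x0).

Definition hpi_rel_pt (X : diffeologicalType R) (A : set X) (x0 : A) : hpi_rel x0 :=
  hclass (cst_triple x0).

End HomotopySets.

Arguments pair_maps {R} n {X} x0.
Arguments triple_maps {R} n {X A} x0.
Arguments hpi {R} n {X} x0.
Arguments hpi_rel {R} n {X A} x0.
Arguments hpi_pt {R} n {X} x0.
Arguments hpi_rel_pt {R} n {X A} x0.

Section SequenceMaps.
Variables (R : realType) (n : nat) (X : diffeologicalType R) (A : set X) (x0 : A).

Fact incl_pair_subproof (f : pair_maps n x0) :
  \val \o (\val f : cube R n -> A) \in pair_maps n (\val x0).
Proof.
have [sf fb] := set_mem (valP f); rewrite inE; split.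
  exact: smooth_comp sf (@smooth_val _ _ A).
by move=> _ [x bx <-] /=; congr (\val _); apply: fb; exists x.
Qed.

(* On representatives: incl_pair is f |-> i o f, pair_to_triple is the map j
   (the same map I^(n+1) -> X, seen as a map of triples), and face is the
   restriction to I^n x {0}, seen as a map into A. *)
Definition incl_pair (f : pair_maps n x0) : pair_maps n (\val x0) :=
  SigSub (incl_pair_subproof f).

Fact pair_to_triple_subproof (f : pair_maps (n + 1) (\val x0)) :
  \val f \in triple_maps n x0.
Proof.
have [sf fb] := set_mem (valP f); rewrite inE; split=> //.
  by move=> y /fb ->; exact: (set_mem (valP x0)).
by move=> _ [x Jx <-]; apply: fb; exists x => //; exact: Jset_sub_boundary.
Qed.

Definition pair_to_triple (f : pair_maps (n + 1) (\val x0)) : triple_maps n x0 :=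
  SigSub (pair_to_triple_subproof f).

Fact face_in_A (f : triple_maps n x0) (x : cube R n) :
  (\val f : _ -> X) (snoc x (unit0 R)) \in A.
Proof.
have [_ fA _] := set_mem (valP f); apply/mem_set/fA.
by exists (snoc x (unit0 R)) => //; apply/boundary_snoc; constructor 2.
Qed.

Definition face_map (f : triple_maps n x0) : cube R n -> A :=
  fun x => SigSub (face_in_A f x).

Fact face_subproof (f : triple_maps n x0) : face_map f \in pair_maps n x0.
Proof.
have [sf _ fJ] := set_mem (valP f); rewrite inE; split.
  apply: smooth_corestrict.
  exact: smooth_comp (@smooth_snoc _ n (unit0 R)) sf.
move=> _ [x bx <-]; apply/val_inj; apply: fJ.
by exists (snoc x (unit0 R)) => //; exists x, (unit0 R); split=> //; left.
Qed.

Definition face (f : triple_maps n x0) : pair_maps n x0 :=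
  SigSub (face_subproof f).

End SequenceMaps.

(* Exactness of S -> T -> (U, u0) at T. *)
Definition exact_at (S T U : Type) (f : S -> T) (g : T -> U) (u0 : U) :=
  range f = g @^-1` [set u0].

(* Main.v *)
Require Import Defs.
From HB Require Import structures.
From mathcomp Require Import all_boot all_order all_algebra.
From mathcomp Require Import all_classical all_reals all_analysis.
From mathcomp Require Import ring lra.

(** The inclusions of kernels and images are all witnessed by explicit
    homotopies, written below with a point of I^(n+1) as a pair (x, t), x in
    I^n and t in I.

    - At pi_n(A): a homotopy in X, through maps of pairs, from a map into A to
      the constant map is literally a map of triples whose face is the given
      map, and conversely ([incl_null], [incl_face]).
    - At pi_(n+1)(X): a map f into A is contracted, as a map of triples, by
      f(x, (1-s)t + s) ([pair_to_triple_incl]). If H(x, t, s) contracts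
      f = H(-, -, 0) through maps of triples, then g(x, s) = H(x, 0, s) takes
      values in A, and f and g are homotopic because the two edges s = 0 and
      t = 0 of the square can be rotated into each other while the far endpoint
      runs along the edges t = 1 and s = 1, where H is constant
      ([pair_to_triple_null]).
    - At pi_(n+1)(X, A): the face of a map of pairs is constant. If H contracts
      the face of f inside A, then stacking H below f gives a map K of pairs,
      and widening the window [1/2, 1] to [0, 1] in the last coordinate deforms f
      into K ([face_null]).

    The only obstacle with respect to topological spaces is that smooth maps
    cannot be glued along a face. They can once they are independent of the last
    coordinate near the face ([smooth_stack]), which is achieved by
    reparametrizing with a smooth step function, constant near 0 and near 1.
    Such a function is obtained from exp(-1/x) by composition alone. The same
    gluing gives the transitivity of homotopy ([homotopic_trans]). *)

Set Implicit Arguments.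
Unset Strict Implicit.
Unset Printing Implicit Defensive.

Import Order.TTheory GRing.Theory Num.Theory.
Import numFieldNormedType.Exports.
Local Open Scope classical_set_scope.
Local Open Scope ring_scope.

(** * Flat functions *)

Section Flat.
Variable R : realType.

(** The function p(1/x) exp(-1/x) for x > 0, extended by 0. As p varies, these
    functions are stable under differentiation, hence they are all smooth. *)
Definition flat (p : {poly R}) (x : R) : R :=
  if 0 < x then p.[x^-1] * expR (- x^-1) else 0.

Lemma exprn_expRN_le n (y : R) : 0 < y -> y ^+ n * expR (- y) <= n`!%:R.
Proof.
move=> y0; rewrite expRN ler_pdivrMr ?expR_gt0//.
case: n => [|n]; first by rewrite expr0 mul1r -expR0 ler_expR ltW.
have f0 : 0 < n.+1`!%:R :> R by rewrite ltr0n fact_gt0.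
rewrite mulrC -ler_pdivrMr// (le_trans _ (expR_ge1Dxn n (ltW y0)))//.
by rewrite lerDr.
Qed.

Lemma flat_bounded (p : {poly R}) : exists C, forall x, `|flat p x| <= C.
Proof.
exists (\sum_(i < size p) `|p`_i| * i`!%:R) => x; rewrite /flat.
case: ifPn => [x0|_]; last by rewrite normr0 sumr_ge0// => i _; rewrite mulr_ge0.
have y0 : 0 < x^-1 by rewrite invr_gt0.
rewrite normrM (ger0_norm (expR_ge0 _)) horner_coef.
rewrite (le_trans (ler_wpM2r (expR_ge0 _) (ler_norm_sum _ _ _)))//.
rewrite mulr_suml ler_sum// => i _; rewrite normrM -mulrA ler_wpM2l//.
by rewrite ger0_norm ?exprn_ge0 ?(ltW y0)// exprn_expRN_le.
Qed.

(** The derivative of [flat p] is [flat (flat_der p)]: with y = 1/x, the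
    derivative of p(y) exp(-y) in x is y^2 (p(y) - p'(y)) exp(-y). *)
Definition flat_der (p : {poly R}) : {poly R} := 'X^2 * (p - p^`()).

Lemma is_derive_flat (p : {poly R}) (x : R) :
  is_derive x 1 (flat p) (flat (flat_der p) x).
Proof.
have [x0|x0|->] := ltgtP x 0.
- rewrite [flat _ x]/flat ltNge (ltW x0)/=.
  apply: (near_eq_is_derive (f := cst 0)).
  near=> y; rewrite /flat ltNge (ltW _)//=.
  by near: y; exact: lt_nbhsl.
- rewrite [flat _ x]/flat x0.
  have xn0 : x != 0 by rewrite gt_eqF.
  have di : is_derive x (1 : R) (GRing.inv : R -> R) (- x^-2).
    apply: DeriveDef; first by apply: derivableV => //; exact: derivable_id.
    by rewrite deriveV// ?derive_id ?scaler1//; exact: derivable_id.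
  have dp : is_derive x (1 : R) (horner p \o GRing.inv) (- x^-2 * p^`().[x^-1]).
    by rewrite mulrC; exact: is_derive1_comp.
  have de : is_derive x (1 : R) (expR \o (-%R \o GRing.inv)) (expR (- x^-1) * x^-2).
    rewrite -[X in _ * X]opprK; apply: is_derive1_comp => //.
  suff d : is_derive x (1 : R) ((horner p \o GRing.inv) * (expR \o (-%R \o GRing.inv)))
      ((flat_der p).[x^-1] * expR (- x^-1)).
    apply: near_eq_is_derive d; near=> y; rewrite /flat ifT//.
    by near: y; exact: lt_nbhsr.
  apply: (is_derive_eq (is_deriveM dp de)).
  rewrite /flat_der !hornerE /= !scalerAl /GRing.scale/= -exprVn; ring.
(* At 0, boundedness of flat (X^2 p) gives |flat p h| <= C h^2. *)
have [C CP] := flat_bounded ('X^2 * p).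
have C0 : 0 <= C by exact: le_trans (CP 0).
have bd h : `|flat p h| <= C * `|h| ^+ 2.
  have [h0|h0] := ltP 0 h; last by rewrite {1}/flat ltNge h0/= normr0 mulr_ge0.
  have := CP h; rewrite /flat h0 hornerM hornerXn -mulrA normrM => H.
  rewrite -ler_pdivrMr ?exprn_gt0 ?normr_gt0 ?gt_eqF//.
  by rewrite mulrC -exprVn -normfV -normrX.
suff L : h^-1 *: ((flat p \o shift 0) (h *: 1) - flat p 0) @[h --> (0:R)^'] --> (0 : R).
  rewrite [flat _ 0]/flat ltxx; apply: DeriveDef; first by apply/cvg_ex; exists 0.
  exact/cvg_lim.
apply/cvgr0Pnorm_le => e e0; near=> h.
rewrite /= addr0 {2}/flat ltxx subr0 /GRing.scale/= mulr1 normrM normfV.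
have h0 : 0 < `|h| by rewrite normr_gt0; near: h; exact: nbhs_dnbhs_neq.
rewrite ler_pdivrMl// (le_trans (bd h))// expr2 mulrA mulrC ler_wpM2l//.
have he : `|h| <= e / (C + 1).
  near: h; apply: dnbhs0_le; rewrite divr_gt0//; lra.
have C1 : 0 < C + 1 by lra.
rewrite (le_trans (ler_wpM2l C0 he))// mulrCA ger_pMr// ler_pdivrMr//; lra.
Unshelve. all: by end_near. Qed.

Lemma differentiable_flat (p : {poly R}) (x : R) : differentiable (flat p) x.
Proof. by apply/derivable1_diffP; have [] := is_derive_flat p x. Qed.

Lemma Ck_flat (V : normedModType R) k (U : set V) (a : V -> R) (p : {poly R}) :
  open U -> Ck k U a -> Ck k U (flat p \o a).
Proof.
move=> oU; elim: k p => [|k IH] p /=.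
  move=> ca x Ux; apply: continuous_comp; first exact: ca.
  exact/differentiable_continuous/differentiable_flat.
move=> ka; have [da Da] := ka; split=> [x Ux|v].
  by apply: differentiable_comp; [exact: da|exact: differentiable_flat].
apply: (@Ck_ext _ _ _ _ _ (fun x => 'D_v a x *: (flat (flat_der p) \o a) x)) => // [x Ux|].
  have dfa := differentiable_flat p (a x).
  rewrite (deriveE _ (differentiable_comp (da x Ux) dfa)) (diff_comp (da x Ux) dfa).
  rewrite /= -(deriveE _ (da x Ux)) deriv1E; last exact/derivable1_diffP.
  by rewrite derive1E; have [_ ->] := is_derive_flat p (a x).
by apply: CkZ => //; apply: IH; exact: CkS.
Qed.

(** * A smooth step function *)

Lemma flat1E (x : R) : flat 1 x = if 0 < x then expR (- x^-1) else 0.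
Proof. by rewrite /flat hornerC mul1r. Qed.

Lemma flat1_le : {homo flat (1 : {poly R}) : x y / x <= y}.
Proof.
move=> x y xy; rewrite !flat1E.
have [x0|x0] := ltP 0 x; last by case: ifP => // _; exact: expR_ge0.
by rewrite (lt_le_trans x0 xy) ler_expR lerN2 lef_pV2// posrE// (lt_le_trans x0 xy).
Qed.

Lemma flat1_ge0 (x : R) : 0 <= flat 1 x.
Proof. by rewrite flat1E; case: ifP => // _; exact: expR_ge0. Qed.

Lemma flat1_gt0 (x : R) : 0 < x -> 0 < flat 1 x.
Proof. by move=> x0; rewrite flat1E x0 expR_gt0. Qed.

Lemma flat1_le0 (x : R) : x <= 0 -> flat 1 x = 0.
Proof. by move=> x0; rewrite /flat ltNge x0. Qed.

(** A smooth function R -> [0, 1] that is 0 for x <= 1/3 and 1 for x >= 2/3.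
    With F = flat 1 and c = F(1/3), the argument c - F(x - 1/3) equals c on the
    left of 1/3 and is nonpositive on the right of 2/3. *)
Definition step (x : R) : R :=
  1 - flat 1 (flat 1 3^-1 - flat 1 (x - 3^-1)) / flat 1 (flat 1 3^-1).

Let c_gt0 : 0 < flat 1 (3^-1 : R). Proof. by apply: flat1_gt0; lra. Qed.
Let fc_gt0 : 0 < flat 1 (flat 1 (3^-1 : R)). Proof. exact: flat1_gt0. Qed.

Lemma step0 (x : R) : x <= 3^-1 -> step x = 0.
Proof.
move=> x3; rewrite /step (@flat1_le0 (x - _)) ?subr_le0// subr0 divff ?subrr//.
by rewrite gt_eqF.
Qed.

Lemma step1 (x : R) : 2 / 3 <= x -> step x = 1.
Proof.
move=> x3; rewrite /step (@flat1_le0 (_ - _)) ?mul0r ?subr0//.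
by rewrite subr_le0 flat1_le//; lra.
Qed.

Lemma step_in (x : R) : step x \in unit_interval R.
Proof.
rewrite inE /unit_interval/= in_itv/= /step subr_ge0 gerBl; apply/andP; split.
  rewrite ler_pdivrMr// mul1r flat1_le// gerBl; exact: flat1_ge0.
by rewrite divr_ge0 ?flat1_ge0.
Qed.

Lemma Ck_step (V : normedModType R) k (U : set V) (a : V -> R) :
  open U -> Ck k U a -> Ck k U (step \o a).
Proof.
move=> oU ka.
have aff (b : V -> R) (u v : R) : Ck k U b -> Ck k U (fun x => u + v * b x).
  by move=> kb; apply: CkD => //; [exact: Ck_cst|apply: CkZ => //; exact: Ck_cst].
have k1 : Ck k U (flat 1 \o (fun x => - 3^-1 + 1 * a x)) by apply: Ck_flat => //; exact: aff.
have k2 := Ck_flat 1 oU (aff _ (flat 1 3^-1) (-1) k1).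
apply: Ck_ext (aff _ 1 (- (flat 1 (flat 1 3^-1))^-1) k2) => // x _ /=.
by rewrite /step /= mul1r (addrC (- 3^-1)) mulN1r mulNr mulrC.
Qed.

End Flat.

(** * Smooth real functions and gluing on diffeological spaces *)

Section SmoothFunctions.
Variable R : realType.
Implicit Types Y Z : diffeologicalType R.

(** Smoothness of a function from a diffeological space to the real line, stated
    on plots. *)
Definition smooth_fun Y (a : Y -> R) :=
  forall n (U : set 'rV[R]_n) (p : 'rV[R]_n -> Y), plot U p -> smooth_on U (a \o p).

Lemma smooth_fun_cst Y (r : R) : smooth_fun (fun _ : Y => r).
Proof. by move=> n U p pU k; exact: Ck_cst. Qed.

Lemma smooth_funD Y (a b : Y -> R) :
  smooth_fun a -> smooth_fun b -> smooth_fun (fun y => a y + b y).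
Proof.
by move=> sa sb n U p pU k; apply: CkD (sa _ _ _ pU k) (sb _ _ _ pU k); exact: plot_open pU.
Qed.

Lemma smooth_funM Y (a b : Y -> R) :
  smooth_fun a -> smooth_fun b -> smooth_fun (fun y => a y * b y).
Proof.
by move=> sa sb n U p pU k; apply: CkZ (sa _ _ _ pU k) (sb _ _ _ pU k); exact: plot_open pU.
Qed.

Lemma smooth_funB Y (a b : Y -> R) :
  smooth_fun a -> smooth_fun b -> smooth_fun (fun y => a y - b y).
Proof.
move=> sa sb; apply: smooth_funD => //.
under [X in smooth_fun X]eq_fun do rewrite -mulN1r.
by apply: smooth_funM => //; exact: smooth_fun_cst.
Qed.

Lemma smooth_fun_step Y (a : Y -> R) : smooth_fun a -> smooth_fun (@step R \o a).
Proof. by move=> sa n U p pU k; apply: Ck_step (sa _ _ _ pU k); exact: plot_open pU. Qed.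

Lemma smooth_fun_comp Y Z (h : Y -> Z) (a : Z -> R) :
  smooth h -> smooth_fun a -> smooth_fun (a \o h).
Proof. by move=> sh sa n U p /sh; exact: sa. Qed.

Lemma plot_sub Y n (U V : set 'rV[R]_n) (p : 'rV[R]_n -> Y) :
  open V -> V `<=` U -> plot U p -> plot V p.
Proof. by move=> oV VU; apply: (@plot_comp _ _ n n V U id) => // k; exact: Ck_id. Qed.

(** Two smooth maps can be glued along the zero set of a smooth function c provided
    they agree on a whole neighbourhood |c| < e of it. *)
Lemma smooth_glue Y Z (c : Y -> R) (e : R) (f g : Y -> Z) : 0 < e ->
  smooth_fun c -> smooth f -> smooth g ->
  (forall y, `|c y| < e -> f y = g y) ->
  smooth (fun y => if 0 <= c y then f y else g y).
Proof.
move=> e0 sc sf sg fg n U p pU; have oU := plot_open _ _ _ pU.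
have op (W : set R) : open W -> open (U `&` ((c \o p) @^-1` W)).
  move=> oW; rewrite openE => u [Uu Wu]; apply: filterI; first exact: open_nbhs_nbhs.
  have cc := sc _ _ _ pU 0%N u Uu.
  by apply: cc; exact: open_nbhs_nbhs.
apply: plot_local => // u Uu.
have [cu|cu] := ltP (- e) (c (p u)).
  exists (U `&` ((c \o p) @^-1` [set x | - e < x])); split; [by []|by move=> ? []|].
  have oV := op _ (@open_gt R (- e)).
  apply: plot_ext (plot_sub oV (@subIsetl _ _ _) (sf _ _ _ pU)) => v [Uv ve] /=.
  by case: ifPn => // c0; apply: fg; rewrite ltr_norml ve/= (lt_trans _ e0)// ltNge.
exists (U `&` ((c \o p) @^-1` [set x | x < e])); split; [|by move=> ? []|].
  by split=> //=; rewrite (le_lt_trans cu)//; lra.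
have oV := op _ (@open_lt R e).
apply: plot_ext (plot_sub oV (@subIsetl _ _ _) (sg _ _ _ pU)) => v [Uv ve] /=.
case: ifPn => // c0; symmetry; apply: fg; rewrite ltr_norml ve andbT.
by rewrite (lt_le_trans _ c0)// oppr_lt0.
Qed.

End SmoothFunctions.

(** * Coordinates on cubes *)

Section CubeMaps.
Variable R : realType.
Local Notation unit0 := (unit0 R).
Local Notation unit1 := (unit1 R).

Lemma unit_interval_bounds (s : unit_interval R) : 0 <= \val s /\ \val s <= 1.
Proof.
by have := set_mem (valP s); rewrite /unit_interval/= in_itv/= => /andP.
Qed.

Fact mixU_subproof (s t u : unit_interval R) :
  (1 - \val s) * \val t + \val s * \val u \in unit_interval R.
Proof.
have [s0 s1] := unit_interval_bounds s.
have [t0 t1] := unit_interval_bounds t.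
have [u0 u1] := unit_interval_bounds u.
rewrite inE /unit_interval/= in_itv/=.
apply/andP; split; first by rewrite addr_ge0 ?mulr_ge0// subr_ge0.
by rewrite -[leRHS](subrK (\val s) 1) lerD// ler_piMr// subr_ge0.
Qed.

(** The point (1 - s) t + s u of the unit interval. *)
Definition mixU (s t u : unit_interval R) : unit_interval R :=
  SigSub (mixU_subproof s t u).

(** The step function with values in the unit interval. *)
Definition stepU (x : R) : unit_interval R := SigSub (step_in x).

Lemma stepU0 (x : R) : x <= 3^-1 -> stepU x = unit0.
Proof. by move=> x3; apply/val_inj; exact: step0. Qed.

Lemma stepU1 (x : R) : 2 / 3 <= x -> stepU x = unit1.
Proof. by move=> x3; apply/val_inj; exact: step1. Qed.

Lemma mixU0 t u : mixU unit0 t u = t.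
Proof. by apply/val_inj; rewrite /= subr0 mul1r mul0r addr0. Qed.

Lemma mixU1 t u : mixU unit1 t u = u.
Proof. by apply/val_inj; rewrite /= subrr mul0r mul1r add0r. Qed.

Lemma mixUxx s t : mixU s t t = t.
Proof. by apply/val_inj; rewrite /= mulrBl mul1r subrK. Qed.

Fact cinit_subproof n (z : cube R (n + 1)) : lsubmx (\val z) \in cube R n.
Proof. by rewrite inE => i; rewrite mxE; exact: (set_mem (valP z)). Qed.

(** The first n coordinates of a point of I^(n+1); [clast] is the last one. *)
Definition cinit n (z : cube R (n + 1)) : cube R n := SigSub (cinit_subproof z).

Fact clast_subproof n (z : cube R (n + 1)) : (\val z) 0 (rshift n 0) \in unit_interval R.
Proof. by apply/mem_set; exact: (set_mem (valP z)). Qed.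

Definition clast n (z : cube R (n + 1)) : unit_interval R := SigSub (clast_subproof z).

Lemma cinitK n (x : cube R n) t : cinit (snoc x t) = x.
Proof. by apply/val_inj; rewrite /= row_mxKl. Qed.

Lemma clastK n (x : cube R n) t : clast (snoc x t) = t.
Proof. by apply/val_inj; rewrite /= row_mxEr mxE. Qed.

Lemma snocK n (z : cube R (n + 1)) : snoc (cinit z) (clast z) = z.
Proof.
apply/val_inj; rewrite /= -[RHS]hsubmxK; congr row_mx.
by apply/rowP => i; rewrite ord1 !mxE.
Qed.

Lemma smooth_fun_coord n i : smooth_fun (fun z : cube R n => (\val z) 0 i).
Proof. by move=> m U p [oU sp] k; exact/Ck_coord/sp. Qed.

Lemma smooth_fun_clast n : smooth_fun (fun z : cube R (n + 1) => \val (clast z)).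
Proof. exact: smooth_fun_coord. Qed.

Lemma smooth_coords (Y : diffeologicalType R) n (h : Y -> cube R n) :
  (forall i, smooth_fun (fun y => (\val (h y)) 0 i)) -> smooth h.
Proof.
move=> sh m U p pU; have oU := plot_open _ _ _ pU; split=> // k.
by apply: Ck_row => // j; exact: sh pU k.
Qed.

Lemma smooth_cinit n : smooth (@cinit n).
Proof.
apply: smooth_coords => i; under [X in smooth_fun X]eq_fun do rewrite /= mxE.
exact: smooth_fun_coord.
Qed.

Lemma smooth_snoc2 (Y : diffeologicalType R) n (h : Y -> cube R n)
    (t : Y -> unit_interval R) :
  smooth h -> smooth_fun (\val \o t) -> smooth (fun y => snoc (h y) (t y)).
Proof.
move=> sh st; apply: smooth_coords => i; case: (split_ordP i) => j ->.
  under [X in smooth_fun X]eq_fun do rewrite /= row_mxEl.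
  exact: smooth_fun_comp sh (@smooth_fun_coord n j).
rewrite (_ : (fun _ => _) = \val \o t)//.
by apply/funext => y; rewrite /= row_mxEr mxE ord1.
Qed.

Lemma smooth_fun_mixU (Y : diffeologicalType R) (s t u : Y -> unit_interval R) :
  smooth_fun (\val \o s) -> smooth_fun (\val \o t) -> smooth_fun (\val \o u) ->
  smooth_fun (fun y => \val (mixU (s y) (t y) (u y))).
Proof.
move=> ss st su; apply: smooth_funD; apply: smooth_funM => //.
by apply: smooth_funB => //; exact: smooth_fun_cst.
Qed.

(** The map on I^n x I that is a on the upper half of the last coordinate and b,
    with that coordinate reversed, on the lower half; both are reparametrized by
    the step function, so that the result does not depend on the last coordinate
    near 1/2 when a(x, 0) = b(x, 0). *)
Definition stack n (X : Type) (a b : cube R (n + 1) -> X) (z : cube R (n + 1)) : X :=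
  if 0 <= 2 * \val (clast z) - 1 then a (snoc (cinit z) (stepU (2 * \val (clast z) - 1)))
  else b (snoc (cinit z) (stepU (1 - 2 * \val (clast z)))).

Lemma smooth_stack n (X : diffeologicalType R) (a b : cube R (n + 1) -> X) :
  smooth a -> smooth b -> (forall x, a (snoc x unit0) = b (snoc x unit0)) ->
  smooth (stack a b).
Proof.
move=> sa sb ab.
have sl : smooth_fun (fun z : cube R (n + 1) => 2 * \val (clast z)).
  by apply: smooth_funM; [exact: smooth_fun_cst|exact: smooth_fun_clast].
have sc : smooth_fun (fun z : cube R (n + 1) => 2 * \val (clast z) - 1).
  by apply: smooth_funB => //; exact: smooth_fun_cst.
apply: (@smooth_glue _ _ _ (fun z => 2 * \val (clast z) - 1) 3^-1); first by lra.
- exact: sc.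
- apply: smooth_comp sa; apply: smooth_snoc2; first exact: smooth_cinit.
  exact: smooth_fun_step sc.
- apply: smooth_comp sb; apply: smooth_snoc2; first exact: smooth_cinit.
  apply: (smooth_fun_step (a := fun z => 1 - 2 * \val (clast z))).
  by apply: smooth_funB => //; exact: smooth_fun_cst.
- move=> z; rewrite ltr_norml => /andP[z1 z2].
  by rewrite !stepU0 ?ab//; lra.
Qed.

End CubeMaps.

(** * Homotopy classes *)

Section Homotopy.
Variables (R : realType) (n : nat) (X : diffeologicalType R).
Variable P : set (cube R n -> X).
Local Notation unit0 := (unit0 R).
Local Notation unit1 := (unit1 R).

Lemma stackE (a b : cube R (n + 1) -> X) x t : stack a b (snoc x t) =
  if 0 <= 2 * \val t - 1 then a (snoc x (stepU (2 * \val t - 1)))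
  else b (snoc x (stepU (1 - 2 * \val t))).
Proof. by rewrite /stack cinitK clastK. Qed.

Lemma stack0 (a b : cube R (n + 1) -> X) x :
  stack a b (snoc x unit0) = b (snoc x unit1).
Proof. by rewrite stackE ifF ?stepU1//=; lra. Qed.

Lemma stack1 (a b : cube R (n + 1) -> X) x :
  stack a b (snoc x unit1) = a (snoc x unit1).
Proof. by rewrite stackE ifT ?stepU1//=; lra. Qed.

(** A homotopy given as a curried map (x, t) |-> h x t. *)
Lemma homotopic_build (f g : cube R n -> X) (h : cube R n -> unit_interval R -> X) :
  smooth (fun z => h (cinit z) (clast z)) -> (forall t, P (h^~ t)) ->
  h^~ unit0 =1 f -> h^~ unit1 =1 g -> homotopic P f g.
Proof.
move=> sh hP h0 h1; exists (fun z => h (cinit z) (clast z)); split=> //.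
- by move=> x; rewrite cinitK clastK h0.
- by move=> x; rewrite cinitK clastK h1.
- move=> t; rewrite (_ : (fun _ => _) = h^~ t)//.
  by apply/funext => x; rewrite cinitK clastK.
Qed.

Lemma homotopic_refl (f : cube R n -> X) : smooth f -> P f -> homotopic P f f.
Proof.
move=> sf Pf; apply: (@homotopic_build _ _ (fun x _ => f x)) => //.
exact: smooth_comp (@smooth_cinit _ _) sf.
Qed.

Lemma homotopic_sym (f g : cube R n -> X) : homotopic P f g -> homotopic P g f.
Proof.
move=> [H [sH H0 H1 HP]].
apply: (@homotopic_build _ _ (fun x t => H (snoc x (mixU t unit1 unit0)))) => //.
- apply: smooth_comp sH; apply: smooth_snoc2; first exact: smooth_cinit.
  apply: smooth_fun_mixU; first exact: smooth_fun_clast.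
  + exact: smooth_fun_cst.
  + exact: smooth_fun_cst.
- by move=> x /=; rewrite mixU0 H1.
- by move=> x /=; rewrite mixU1 H0.
Qed.

Lemma homotopic_trans (f g h : cube R n -> X) :
  homotopic P f g -> homotopic P g h -> homotopic P f h.
Proof.
move=> /homotopic_sym [H [sH H0 H1 HP]] [K [sK K0 K1 KP]].
(* H is the reverse homotopy, from g to f: it and K agree at time 0. *)
exists (stack K H); split.
- by apply: smooth_stack => // x; rewrite H0 K0.
- by move=> x; rewrite stack0 H1.
- by move=> x; rewrite stack1 K1.
- move=> t; case: (boolP (0 <= 2 * \val t - 1)) => t0.
    rewrite (_ : (fun _ => _) = fun x => K (snoc x (stepU (2 * \val t - 1)))) //.
    by apply/funext => x; rewrite stackE t0.
  rewrite (_ : (fun _ => _) = fun x => H (snoc x (stepU (1 - 2 * \val t)))) //.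
  by apply/funext => x; rewrite stackE (negbTE t0).
Qed.

Lemma hclass_eq (P_smooth : forall f, P f -> smooth f) (f g : P) :
  hclass f = hclass g <-> homotopic P (\val f) (\val g).
Proof.
split=> [/(congr1 val) /= fg|fg].
  have : homotopy_class P (\val g) (\val g).
    by apply: homotopic_refl; [apply: P_smooth|]; exact: (set_mem (valP g)).
  by rewrite -fg.
apply/val_inj/seteqP; split=> h /=; apply: homotopic_trans => //.
exact: homotopic_sym.
Qed.

Lemma hclass_surj (c : homotopy_classes P) : exists f : P, hclass f = c.
Proof.
have [f Pf fc] := set_mem (valP c).
by exists (SigSub (mem_set Pf)); apply/val_inj.
Qed.

End Homotopy.

Section Induced.
Variables (R : realType) (m n : nat) (X Y : diffeologicalType R).
Variables (P : set (cube R m -> X)) (Q : set (cube R n -> Y)).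

(** The map induced on homotopy classes by a map F on representatives; it is
    defined by choosing a representative of each class, and is meaningful when F
    respects homotopy ([inducedE]). *)
Definition induced (F : P -> Q) (c : homotopy_classes P) : homotopy_classes Q :=
  hclass (F (projT1 (cid (hclass_surj c)))).

Lemma inducedE (F : P -> Q) :
  (forall f, P f -> smooth f) -> (forall f, Q f -> smooth f) ->
  (forall f g, homotopic P (\val f) (\val g) ->
    homotopic Q (\val (F f)) (\val (F g))) ->
  forall f, induced F (hclass f) = hclass (F f).
Proof.
move=> sP sQ FH f; apply/(hclass_eq sQ)/FH/(hclass_eq sP).
by rewrite (projT2 (cid (hclass_surj (hclass f)))).
Qed.

End Induced.

(** Exactness of a sequence of induced maps, read on representatives. *)
Lemma exact_at_hclass (R : realType) (l m n : nat) (X Y Z : diffeologicalType R)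
    (P : set (cube R l -> X)) (Q : set (cube R m -> Y)) (W : set (cube R n -> Z))
    (F : P -> Q) (G : Q -> W) (w : W)
    (F' : homotopy_classes P -> homotopy_classes Q)
    (G' : homotopy_classes Q -> homotopy_classes W) :
  (forall f, Q f -> smooth f) -> (forall f, W f -> smooth f) ->
  (forall f, F' (hclass f) = hclass (F f)) ->
  (forall g, G' (hclass g) = hclass (G g)) ->
  (forall f, homotopic W (\val (G (F f))) (\val w)) ->
  (forall g, homotopic W (\val (G g)) (\val w) ->
    exists f, homotopic Q (\val (F f)) (\val g)) ->
  exact_at F' G' (hclass w).
Proof.
move=> sQ sW FE GE FG0 kerG; apply/seteqP; split=> [_ [c _ <-]|c] /=.
  by have [f <-] := hclass_surj c; rewrite FE GE; exact/(hclass_eq sW)/FG0.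
have [g <-] := hclass_surj c; rewrite GE => /(hclass_eq sW)/kerG [f fg].
by exists (hclass f) => //; rewrite FE; exact/(hclass_eq sQ).
Qed.

(** * Maps of pairs and of triples *)

Section Pair.
Variables (R : realType) (n : nat) (X : diffeologicalType R) (A : set X) (x0 : A).
Local Notation unit0 := (unit0 R).
Local Notation unit1 := (unit1 R).
Local Notation b0 := (\val x0).

Lemma pair_mapsP (Y : diffeologicalType R) (y0 : Y) (m : nat) (f : cube R m -> Y) :
  pair_maps m y0 f <-> smooth f /\ forall x, boundary R m x -> f x = y0.
Proof.
split=> -[sf fb]; split=> //; last by move=> _ [x /fb ? <-].
by move=> x bx; apply: fb; exists x.
Qed.

Lemma pair_mapsS (Y : diffeologicalType R) (y0 : Y) (m : nat) (f : cube R (m + 1) -> Y) :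
  smooth f -> (forall x t, boundary R m x -> f (snoc x t) = y0) ->
  (forall x, f (snoc x unit0) = y0) -> (forall x, f (snoc x unit1) = y0) ->
  pair_maps (m + 1) y0 f.
Proof.
move=> sf fb f0 f1; apply/pair_mapsP; split=> // z; rewrite -(snocK z).
by move=> /boundary_snoc[/fb//|->|->].
Qed.

Lemma triple_mapsP (f : cube R (n + 1) -> X) : triple_maps n x0 f <->
  [/\ smooth f, forall x t, boundary R n x -> f (snoc x t) = b0,
      forall x, f (snoc x unit1) = b0 & forall x, A (f (snoc x unit0))].
Proof.
split=> [[sf fA fJ]|[sf fb f1 f0]].
  split=> // [x t bx|x|x].
  - by apply: fJ; exists (snoc x t) => //; exists x, t; split=> //; left.
  - by apply: fJ; exists (snoc x unit1) => //; exists x, unit1; split=> //; right.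
  - by apply: fA; exists (snoc x unit0) => //; apply/boundary_snoc; constructor 2.
have A0 : A b0 by exact: (set_mem (valP x0)).
split=> //.
  move=> _ [z bz <-]; move: bz; rewrite -(snocK z) => /boundary_snoc[/fb->//|->//|->].
  by rewrite f1.
by move=> _ [_ [x [t [-> [bx|->]]]] <-]; [exact: fb|exact: f1].
Qed.

(** A map into X with values in A, as a map into A. *)
Definition corestr m (f : cube R m -> X) (fA : forall z, A (f z)) : cube R m -> A :=
  fun z => SigSub (mem_set (fA z)).

Lemma smooth_edge m (t : unit_interval R) :
  smooth (fun z : cube R (m + 1) => snoc (snoc (cinit z) t) (clast z)).
Proof.
apply: smooth_snoc2; last exact: smooth_fun_clast.
exact: smooth_comp (@smooth_cinit _ _) (@smooth_snoc _ _ t).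
Qed.

Lemma face_homotopic (f g : triple_maps n x0) :
  homotopic (triple_maps n x0) (\val f) (\val g) ->
  homotopic (pair_maps n x0) (\val (face f)) (\val (face g)).
Proof.
move=> [H [sH H0 H1 HP]].
have HA x t : A (H (snoc (snoc x unit0) t)) by have [] := (triple_mapsP _).1 (HP t).
exists (corestr (fun z => HA (cinit z) (clast z))); split.
- apply: smooth_corestrict; exact: smooth_comp (smooth_edge unit0) sH.
- by move=> x; apply/val_inj; rewrite /= cinitK clastK H0.
- by move=> x; apply/val_inj; rewrite /= cinitK clastK H1.
- move=> t; have [sHt Hb _ _] := (triple_mapsP _).1 (HP t); apply/pair_mapsP; split.
    apply: smooth_corestrict.
    rewrite (_ : _ \o _ = fun x => H (snoc (snoc x unit0) t)).
      exact: smooth_comp (@smooth_snoc _ _ unit0) sHt.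
    by apply/funext => x; rewrite /= cinitK clastK.
  by move=> x bx; apply/val_inj; rewrite /= cinitK clastK Hb.
Qed.

Lemma incl_homotopic (f g : pair_maps n x0) :
  homotopic (pair_maps n x0) (\val f) (\val g) ->
  homotopic (pair_maps n b0) (\val (incl_pair f)) (\val (incl_pair g)).
Proof.
move=> [H [sH H0 H1 HP]]; exists (\val \o H); split.
- exact: smooth_comp sH (@smooth_val _ _ A).
- by move=> x /=; rewrite H0.
- by move=> x /=; rewrite H1.
- by move=> t; exact: (set_mem (incl_pair_subproof (SigSub (mem_set (HP t))))).
Qed.

Lemma pair_to_triple_homotopic (f g : pair_maps (n + 1) b0) :
  homotopic (pair_maps (n + 1) b0) (\val f) (\val g) ->
  homotopic (triple_maps n x0) (\val (pair_to_triple f)) (\val (pair_to_triple g)).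
Proof.
move=> [H [sH H0 H1 HP]]; exists H; split=> // t.
exact: (set_mem (pair_to_triple_subproof (SigSub (mem_set (HP t))))).
Qed.

(** * Exactness *)

Lemma incl_face (f : triple_maps n x0) :
  homotopic (pair_maps n b0) (\val (incl_pair (face f))) (\val (cst_pair n b0)).
Proof.
have [sf fb f1 _] := (triple_mapsP _).1 (set_mem (valP f)).
exists (\val f); split=> // t; apply/pair_mapsP; split; last by move=> x; exact: fb.
exact: smooth_comp (@smooth_snoc _ _ t) sf.
Qed.

Lemma incl_null (f : pair_maps n x0) :
  homotopic (pair_maps n b0) (\val (incl_pair f)) (\val (cst_pair n b0)) ->
  exists g : triple_maps n x0, face g = f.
Proof.
move=> [H [sH H0 H1 HP]].
have TH : triple_maps n x0 H.
  apply/triple_mapsP; split=> //.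
  - by move=> x t; exact: ((pair_mapsP _ _).1 (HP t)).2.
  - by move=> x; rewrite H0; exact: (set_mem (valP (_ : A))).
exists (SigSub (mem_set TH)); apply/val_inj/funext => x; apply/val_inj.
exact: H0.
Qed.

Lemma pair_to_triple_incl (f : pair_maps (n + 1) x0) :
  homotopic (triple_maps n x0) (\val (pair_to_triple (incl_pair f)))
    (\val (cst_triple n x0)).
Proof.
have [sf fb] := (pair_mapsP _ _).1 (set_mem (valP f)).
have svf : smooth (\val \o \val f) := smooth_comp sf (@smooth_val _ _ A).
pose h (z : cube R (n + 1)) s := \val (\val f (snoc (cinit z) (mixU s (clast z) unit1))) : X.
apply: (@homotopic_build _ _ _ _ _ _ h) => //.
- apply: smooth_comp svf; apply: smooth_snoc2.
    exact: smooth_comp (@smooth_cinit _ _) (@smooth_cinit _ _).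
  apply: smooth_fun_mixU; first exact: smooth_fun_clast.
    exact: smooth_fun_comp (@smooth_cinit _ _) (@smooth_fun_clast _ _).
  exact: smooth_fun_cst.
- move=> s; apply/triple_mapsP; split.
  + apply: smooth_comp svf; apply: smooth_snoc2; first exact: smooth_cinit.
    apply: smooth_fun_mixU; [exact: smooth_fun_cst|exact: smooth_fun_clast|].
    exact: smooth_fun_cst.
  + move=> x t bx; rewrite /h cinitK fb//; apply/boundary_snoc; by constructor 1.
  + move=> x; rewrite /h clastK mixUxx fb//; apply/boundary_snoc; by constructor 3.
  + by move=> x; exact: (set_mem (valP (_ : A))).
- by move=> z; rewrite /h mixU0 snocK.
- move=> z; rewrite /h mixU1 fb//; apply/boundary_snoc; by constructor 3.
Qed.

Lemma pair_to_triple_null (f : pair_maps (n + 1) b0) :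
  homotopic (triple_maps n x0) (\val (pair_to_triple f)) (\val (cst_triple n x0)) ->
  exists g : pair_maps (n + 1) x0,
    homotopic (pair_maps (n + 1) b0) (\val (incl_pair g)) (\val f).
Proof.
move=> [H [sH /= H0 H1 HP]].
have [sf fb] := (pair_mapsP _ _).1 (set_mem (valP f)).
have HA x t : A (H (snoc (snoc x unit0) t)) by have [] := (triple_mapsP _).1 (HP t).
have Hb x t s : boundary R n x -> H (snoc (snoc x t) s) = b0.
  by have [_ + _ _] := (triple_mapsP _).1 (HP s); apply.
have Hr x s : H (snoc (snoc x unit1) s) = b0.
  by have [_ _ + _] := (triple_mapsP _).1 (HP s); apply.
have Hl x : H (snoc (snoc x unit0) unit0) = b0.
  by rewrite H0 fb//; apply/boundary_snoc; constructor 2.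
pose g := corestr (fun z => HA (cinit z) (clast z)).
have gP : pair_maps (n + 1) x0 g.
  apply: pair_mapsS.
  - apply: smooth_corestrict; exact: smooth_comp (smooth_edge unit0) sH.
  - by move=> x t bx; apply/val_inj; rewrite /= cinitK clastK Hb.
  - by move=> x; apply/val_inj; rewrite /= cinitK clastK Hl.
  - by move=> x; apply/val_inj; rewrite /= cinitK clastK H1.
exists (SigSub (mem_set gP)); apply: homotopic_sym.
(* The path u |-> (a r * u, b r * u) in the square goes from the edge s = 0
   (r = 0) to the edge t = 0 (r = 1). Since b reaches 1 before a leaves 1, its
   endpoint (a r, b r) always has a coordinate equal to 1. *)
pose a (r : unit_interval R) := mixU (stepU (2 * \val r - 1)) unit1 unit0.
pose b (r : unit_interval R) := stepU (2 * \val r).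
pose h (z : cube R (n + 1)) r :=
  H (snoc (snoc (cinit z) (mixU (a r) unit0 (clast z))) (mixU (b r) unit0 (clast z))).
have sl m : smooth_fun (fun z : cube R (m + 1) => 2 * \val (clast z)).
  by apply: smooth_funM; [exact: smooth_fun_cst|exact: smooth_fun_clast].
have ci m : smooth (@cinit R m) := @smooth_cinit R m.
have cl m : smooth_fun (\val \o @clast R m) := @smooth_fun_clast R m.
apply: (@homotopic_build _ _ _ _ _ _ h) => //.
- apply: smooth_comp sH; apply: smooth_snoc2; first apply: smooth_snoc2.
  + exact: smooth_comp (ci _) (ci _).
  + apply: smooth_fun_mixU; last exact: smooth_fun_comp (ci _) (cl _).
      apply: smooth_fun_mixU; [|exact: smooth_fun_cst..].
      apply: (smooth_fun_step (a := fun z => 2 * \val (clast z) - 1)).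
      by apply: smooth_funB => //; exact: smooth_fun_cst.
    exact: smooth_fun_cst.
  + apply: smooth_fun_mixU; last exact: smooth_fun_comp (ci _) (cl _).
      exact: smooth_fun_step (sl _).
    exact: smooth_fun_cst.
- move=> r; apply: pair_mapsS.
  + apply: smooth_comp sH; apply: smooth_snoc2; first apply: smooth_snoc2 => //.
      by apply: smooth_fun_mixU => //; exact: smooth_fun_cst.
    by apply: smooth_fun_mixU => //; exact: smooth_fun_cst.
  + by move=> x t bx; rewrite /h cinitK Hb.
  + by move=> x; rewrite /h cinitK clastK !mixUxx Hl.
  + move=> x; rewrite /h cinitK clastK.
    have [r1|r1] := leP (2 / 3) (2 * \val r).
      by rewrite /b stepU1// mixU1 H1.
    by rewrite /a stepU0 ?mixU0 ?mixU1 ?Hr//; lra.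
- have -> : h^~ unit0 = fun z => H (snoc (snoc (cinit z) (clast z)) unit0).
    by apply/funext => z; rewrite /h /a /b !stepU0 ?mixU0 ?mixU1//=; lra.
  by move=> z; rewrite snocK H0.
- move=> z; rewrite /h; have -> : a unit1 = unit0 by rewrite /a stepU1 ?mixU1//=; lra.
  have -> : b unit1 = unit1 by rewrite /b stepU1//=; lra.
  by rewrite mixU0 mixU1.
Qed.

Lemma face_pair_to_triple (f : pair_maps (n + 1) b0) :
  face (pair_to_triple f) = cst_pair n x0.
Proof.
have [_ fb] := (pair_mapsP _ _).1 (set_mem (valP f)).
apply/val_inj/funext => x; apply/val_inj/fb.
by apply/boundary_snoc; constructor 2.
Qed.

(** A map of triples may be made independent of the last coordinate near the
    faces t = 0 and t = 1. *)
Lemma homotopic_step (f : triple_maps n x0) :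
  homotopic (triple_maps n x0) (\val f)
    (fun z => \val f (snoc (cinit z) (stepU (\val (clast z))))).
Proof.
have [sf fb f1 f0] := (triple_mapsP _).1 (set_mem (valP f)).
have ci m : smooth (@cinit R m) := @smooth_cinit R m.
have cl m : smooth_fun (\val \o @clast R m) := @smooth_fun_clast R m.
pose h z s := \val f (snoc (cinit z) (mixU s (clast z) (stepU (\val (clast z))))).
apply: (@homotopic_build _ _ _ _ _ _ h) => //.
- apply: smooth_comp sf; apply: smooth_snoc2; first exact: smooth_comp (ci _) (ci _).
  have cil : smooth_fun (fun z : cube R (n + 1 + 1) => \val (clast (cinit z))).
    exact: smooth_fun_comp (ci _) (cl _).
  by apply: smooth_fun_mixU => //; exact: smooth_fun_step cil.
- move=> s; apply/triple_mapsP; split.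
  + apply: smooth_comp sf; apply: smooth_snoc2 => //.
    apply: smooth_fun_mixU => //; first exact: smooth_fun_cst.
    exact: smooth_fun_step (cl n).
  + by move=> x t bx; rewrite /h cinitK fb.
  + by move=> x; rewrite /h cinitK clastK stepU1 ?mixUxx ?f1//=; lra.
  + by move=> x; rewrite /h cinitK clastK stepU0 ?mixUxx; [exact: f0|rewrite /=; lra].
- by move=> z; rewrite /h mixU0 snocK.
- by move=> z; rewrite /h mixU1.
Qed.

Fact half_subproof : 2^-1 \in unit_interval R.
Proof. by rewrite inE /unit_interval/= in_itv/=; apply/andP; split; lra. Qed.

Lemma face_null (f : triple_maps n x0) :
  homotopic (pair_maps n x0) (\val (face f)) (\val (cst_pair n x0)) ->
  exists g : pair_maps (n + 1) b0,
    homotopic (triple_maps n x0) (\val (pair_to_triple g)) (\val f).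
Proof.
move=> [H [sH H0 H1 HP]].
have [sf fb f1 f0] := (triple_mapsP _).1 (set_mem (valP f)).
have ci m : smooth (@cinit R m) := @smooth_cinit R m.
have cl m : smooth_fun (\val \o @clast R m) := @smooth_fun_clast R m.
have Hb x t : boundary R n x -> H (snoc x t) = x0.
  by exact: ((pair_mapsP _ _).1 (HP t)).2.
pose H' z := \val (H z) : X.
have sH' : smooth H' := smooth_comp sH (@smooth_val _ _ A).
pose K := stack (\val f) H'.
have sK : smooth K by apply: smooth_stack => // x; rewrite /H' H0.
have Kb x t : boundary R n x -> K (snoc x t) = b0.
  by move=> bx; rewrite /K stackE; case: ifP => _; [rewrite fb|rewrite /H' Hb].
have K0 x : K (snoc x unit0) = b0 by rewrite /K stack0 /H' H1.
have K1 x : K (snoc x unit1) = b0 by rewrite /K stack1 f1.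
have PK : pair_maps (n + 1) b0 K by exact: pair_mapsS.
exists (SigSub (mem_set PK)); apply: homotopic_sym.
apply: homotopic_trans (homotopic_step f) _.
(* The reparametrized f is K on the window [1/2, 1] of the last coordinate; at
   time s the window is [(1 - s)/2, 1]. Its lower end stays in the lower half of
   K, where K takes its values in A. *)
pose half : unit_interval R := SigSub half_subproof.
pose h z s := K (snoc (cinit z) (mixU s (mixU (clast z) half unit1) (clast z))).
apply: (@homotopic_build _ _ _ _ _ _ h) => //.
- apply: smooth_comp sK; apply: smooth_snoc2; first exact: smooth_comp (ci _) (ci _).
  have cil : smooth_fun (fun z : cube R (n + 1 + 1) => \val (clast (cinit z))).
    exact: smooth_fun_comp (ci _) (cl _).
  by apply: smooth_fun_mixU => //; apply: smooth_fun_mixU => //; exact: smooth_fun_cst.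
- move=> s; apply/triple_mapsP; split.
  + apply: smooth_comp sK; apply: smooth_snoc2 => //.
    apply: smooth_fun_mixU => //; first exact: smooth_fun_cst.
    by apply: smooth_fun_mixU => //; exact: smooth_fun_cst.
  + by move=> x t bx; rewrite /h cinitK Kb.
  + by move=> x; rewrite /h cinitK clastK mixU1 mixUxx K1.
  + move=> x; rewrite /h cinitK clastK mixU0 /K stackE.
    have -> : 2 * \val (mixU s half unit0) - 1 = - \val s by rewrite /=; field.
    case: ifP => _; last by exact: (set_mem (valP (_ : A))).
    by rewrite stepU0; [exact: f0|have [] := unit_interval_bounds s; lra].
- move=> z; rewrite /h mixU0 /K stackE.
  have -> : 2 * \val (mixU (clast z) half unit1) - 1 = \val (clast z).
    by rewrite /=; field.
  by have [-> _] := unit_interval_bounds (clast z).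
- by move=> z; rewrite /h mixU1 snocK.
Qed.

End Pair.

(* hclass is onto, so the first three clauses determine Delta, i and j: they
   are the maps induced on homotopy classes by face, incl_pair and
   pair_to_triple. *)
Theorem proposition3p14 (R : realType) (X : diffeologicalType R) (A : set X)
    (x0 : A) :
  exists (Delta : forall n : nat, hpi_rel n x0 -> hpi n x0)
         (i : forall n : nat, hpi n x0 -> hpi n (\val x0))
         (j : forall n : nat, hpi (n + 1) (\val x0) -> hpi_rel n x0),
    [/\ (forall n (f : triple_maps n x0), Delta n (hclass f) = hclass (face f)),
        (forall n (f : pair_maps n x0), i n (hclass f) = hclass (incl_pair f)) &
        (forall n (f : pair_maps (n + 1) (\val x0)),
           j n (hclass f) = hclass (pair_to_triple f))] /\
    [/\ (forall n, Delta n (hpi_rel_pt n x0) = hpi_pt n x0),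
        (forall n, i n (hpi_pt n x0) = hpi_pt n (\val x0)) &
        (forall n, j n (hpi_pt (n + 1) (\val x0)) = hpi_rel_pt n x0)] /\
    [/\ (forall n, exact_at (Delta n) (i n) (hpi_pt n (\val x0))),
        (forall n, exact_at (i (n + 1)%N) (j n) (hpi_rel_pt n x0)) &
        (forall n, exact_at (j n) (Delta n) (hpi_pt n x0))].
Proof.
have sP (Y : diffeologicalType R) (y : Y) m f : @pair_maps R m Y y f -> smooth f by case.
have sT m f : @triple_maps R m X A x0 f -> smooth f by case.
pose Delta m := induced (@face R m X A x0).
pose i m := induced (@incl_pair R m X A x0).
pose j m := induced (@pair_to_triple R m X A x0).
have DE m f : Delta m (hclass f) = hclass (face f).
  by apply: inducedE; [exact: sT|exact: sP|exact: face_homotopic].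
have iE m f : i m (hclass f) = hclass (incl_pair f).
  by apply: inducedE; [exact: sP|exact: sP|exact: incl_homotopic].
have jE m f : j m (hclass f) = hclass (pair_to_triple f).
  by apply: inducedE; [exact: sP|exact: sT|exact: pair_to_triple_homotopic].
exists Delta, i, j; split; [by []|split; split=> m].
- by rewrite /hpi_rel_pt DE; congr hclass; apply/val_inj/funext => x; exact/val_inj.
- by rewrite /hpi_pt iE; congr hclass; exact/val_inj.
- by rewrite /hpi_pt jE; congr hclass; exact/val_inj.
- apply: exact_at_hclass (@DE m) (@iE m) _ _; [exact: sP|exact: sP| |].
    exact: incl_face.
  move=> f /incl_null[g <-]; exists g; apply: homotopic_refl.
    exact: sP (set_mem (valP (face g))).
  exact: (set_mem (valP (face g))).
- apply: exact_at_hclass (@iE _) (@jE m) _ _; [exact: sP|exact: sT| |].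
    exact: pair_to_triple_incl.
  exact: pair_to_triple_null.
- apply: exact_at_hclass (@jE m) (@DE m) _ _; [exact: sT|exact: sP| |].
    move=> f; rewrite face_pair_to_triple.
    apply: homotopic_refl; first exact: sP (set_mem (valP (cst_pair m x0))).
    exact: (set_mem (valP (cst_pair m x0))).
  exact: face_null.
Qed.
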